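(* Suppose Assumption 1 holds and $\Psi$ is directionally pathwise differentiable at $P$ relative to $\mathcal T$ with derivative $\gamma$. Let $V\subsetneq V'$ be linearity subspaces of $\gamma$ with $V_V<V_{V'}$. Then no $V$-efficient estimator sequence is regular along $V'$, and every estimator sequence $T_n$ regular along $V'$ has $v(T_n)\ge V_{V'}>V_V$. If $\gamma$ is sublinear or superlinear, every linearity subspace is contained in the core $\mathcal H_\kappa$, so every $\mathcal H_\kappa$-efficient estimator sequence is regular along all linearity subspaces.
   Context: Model. $\mathcal P$ is a set of probability measures, $P\in\mathcal P$ fixed, $X_1,\dots,X_n$ i.i.d. observations; $L_2^0(P)$ is the mean-zero subspace of $L_2(P)$ with inner product $\langle\cdot,\cdot\rangle$. A DQM path with score $h$ is a map $t\mapsto P_{t,h}\in\mathcal P$, $t\in[0,\varepsilon)$, $P_{0,h}=P$, with $\int[(dP_{t,h}^{1/2}-dP^{1/2})/t-\tfrac12h\,dP^{1/2}]^2\to0$ as $t\downarrow0$; $P_{n,h}:=P_{n^{-1/2},h}$, $P^n_{n,h}$ its $n$-fold product. $\mathcal T\subseteq L_2^0(P)$ is a linear subspace. Assumption 1: $\mathcal T$ is closed in $L_2(P)$ and every $h\in\mathcal T$ is the score of some DQM path in $\mathcal P$. Directional pathwise differentiability: $\gamma:\mathcal T\to\mathbb R$ is positively homogeneous and $t^{-1}\{\Psi(P_{t,h})-\Psi(P)\}\to\gamma(h)$ for every $h\in\mathcal T$ and every DQM path with score $h$; $\gamma$ is then continuous. $T_n$ is regular along a convex cone $C\subseteq\mathcal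 T$ with limit $L$ if $\sqrt n\{T_n-\Psi(P_{n,h})\}\rightsquigarrow L$ under $P^n_{n,h}$ for every $h\in C$ and every DQM path with score $h$; $\mathcal R^{\rm cone}(T_n)$ is the family of convex cones along which $T_n$ is regular. A linearity subspace is a linear subspace $V\subseteq\mathcal T$ with $\gamma|_V$ linear. $N(\gamma):=\{h\in\mathcal T:\gamma(h)+\gamma(-h)=0\}$; core $\mathcal H_\kappa:=\{w\in N(\gamma):\gamma(v+cw)=\gamma(v)+c\gamma(w)\ \forall v\in N(\gamma),c\in\mathbb R\}$ (a linearity subspace). For a convex cone $C$ (in particular a linearity subspace) on which $\gamma$ agrees with a bounded linear functional on $\operatorname{span}C$, $\tilde\psi_C\in\overline{\operatorname{span}}\,C$ is its Riesz representer and $V_C:=\|\tilde\psi_C\|^2$. $v(T_n):=\sup_{C\in\mathcal R^{\rm cone}(T_n)}V_C$. $T_n$ is $V$-efficient if it is regular along $V$ with limit $N(0,V_V)$. Sublinear: positively homogeneous and subadditive; superlinear: $-\gamma$ sublinear. *)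

(* Defs.v *)
From HB Require Import structures.
From mathcomp Require Import all_boot all_order all_algebra.
From mathcomp Require Import all_classical all_reals all_analysis.
Set Implicit Arguments.
Unset Strict Implicit.
Unset Printing Implicit Defensive.
Import Order.TTheory GRing.Theory Num.Theory.
Import numFieldNormedType.Exports.
Local Open Scope classical_set_scope.
Local Open Scope ring_scope.

Section iid.
Context {d : measure_display} {X : measurableType d} {R : realType}.

Definition consT n (z : X * n.-tuple X) : n.+1.-tuple X :=
  [the n.+1.-tuple X of z.1 :: z.2].

Lemma measurable_consT n : measurable_fun setT (@consT n).
Proof. exact: (measurable_cons measurable_fst measurable_snd). Qed.

HB.instance Definition _ n :=
  isMeasurableFun.Build _ _ _ _ (@consT n) (@measurable_consT n).

Fixpoint iid (P : probability X R) (n : nat) : probability (n.-tuple X) R :=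
  match n with
  | 0 => \d_([tuple] : 0.-tuple X)
  | n'.+1 => distribution (P \x iid P n')%E (@consT n')
  end.

End iid.

(* Elements of L_2(P) are represented by square-integrable functions.  As
   [LfunType] does not identify almost everywhere equal functions, the
   subspaces and cones below are required to be saturated for this relation. *)
Section L2.
Context {d : measure_display} {X : measurableType d} {R : realType}.
Variable P : probability X R.

Definition L2 : Type := LfunType P (lee1n 2).
HB.instance Definition _ := GRing.Lmodule.on L2.

Implicit Types (f g h : L2) (A C V : set L2).

Definition L2dot f g : R := (\int[P]_x (f x * g x))%R.

Definition L2norm f : R := fine 'N[P]_2%:E[EFin \o f].

Definition ae_saturated A :=
  forall f g, A f -> (f : X -> R) = g %[ae P] -> A g.

Definition subspace V :=
  [/\ V 0, forall a f g, V f -> V g -> V (a *: f + g) & ae_saturated V].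

Definition convex_cone C :=
  [/\ C 0, forall f g, C f -> C g -> C (f + g),
      forall (a : R) f, 0 <= a -> C f -> C (a *: f) & ae_saturated C].

Definition L2closure A : set L2 :=
  [set f | forall e : R, 0 < e -> exists2 g, A g & L2norm (f - g) < e].

Definition L2closed A := L2closure A `<=` A.

Definition span A : set L2 :=
  [set h | exists n (a : 'I_n -> R) (f : 'I_n -> L2),
     (forall i, A (f i)) /\ h = \sum_(i < n) a i *: f i].

Definition mean_zero : set L2 := [set f | (\int[P]_x f x)%R = 0].

End L2.

Section dqm.
Context {d : measure_display} {X : measurableType d} {R : realType}.

Definition dominating (Q P : probability X R) : set X -> \bar R :=
  measure_add Q P.

HB.instance Definition _ (Q P : probability X R) :=
  Measure.on (dominating Q P).

Lemma dominating_finite (Q P : probability X R) : fin_num_fun (dominating Q P).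
Proof.
move=> A mA; rewrite /dominating measure_addE fin_numD.
by rewrite !fin_num_measure.
Qed.

HB.instance Definition _ (Q P : probability X R) :=
  Measure_isFinite.Build _ _ _ (dominating Q P) (@dominating_finite Q P).

Definition density (Q : probability X R)
    (mu : {sigma_finite_measure set X -> \bar R}) (x : X) : R :=
  fine (Radon_Nikodym (charge_of_finite_measure Q) mu x).

(* [int [(dQ^{1/2} - dP^{1/2}) / t - h dP^{1/2} / 2]^2], whose value does not
   depend on the dominating measure; Q + P is used. *)
Definition dqm_remainder (P Q : probability X R) (t : R) (h : L2 P) : \bar R :=
  let mu := dominating Q P in
  let rq x := Num.sqrt (density Q mu x) in
  let rp x := Num.sqrt (density P mu x) in
  (\int[mu]_x (((rq x - rp x) / t - 2^-1 * h x * rp x) ^+ 2)%:E)%E.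

(* Only the restriction of [Pt] to [0, eps) is constrained. *)
Definition dqm_path (M : set (probability X R)) (P : probability X R)
    (h : L2 P) (Pt : R -> probability X R) :=
  [/\ exists2 eps : R, 0 < eps & forall t : R, 0 <= t < eps -> M (Pt t),
      Pt 0 = P &
      dqm_remainder (Pt t) t h @[t --> 0^'+] --> 0%E].

Definition pos_homogeneous (P : probability X R) (T : set (L2 P))
    (gamma : L2 P -> R) :=
  forall (a : R) h, 0 <= a -> T h -> gamma (a *: h) = a * gamma h.

Definition subadditive_on (P : probability X R) (T : set (L2 P))
    (gamma : L2 P -> R) :=
  forall g h, T g -> T h -> gamma (g + h) <= gamma g + gamma h.

Definition sublinear (P : probability X R) (T : set (L2 P))
    (gamma : L2 P -> R) :=
  pos_homogeneous T gamma /\ subadditive_on T gamma.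

Definition superlinear (P : probability X R) (T : set (L2 P))
    (gamma : L2 P -> R) :=
  sublinear T (fun h => - gamma h).

(* [T] is a linear subspace of the mean-zero part of L_2(P), closed in
   L_2(P), and each of its elements is the score of a path in the model. *)
Definition tangent_space (M : set (probability X R)) (P : probability X R)
    (T : set (L2 P)) :=
  [/\ subspace T, T `<=` mean_zero (P := P), L2closed T &
      forall h, T h -> exists Pt, dqm_path M h Pt].

(* The values of [Psi] outside of the model and of [gamma] outside of [T] are
   irrelevant.  The first clause says that [gamma] is a function on a subset
   of L_2(P), that is, of almost everywhere equality classes. *)
Definition directionally_differentiable (M : set (probability X R))
    (P : probability X R) (Psi : probability X R -> R) (T : set (L2 P))
    (gamma : L2 P -> R) :=
  [/\ forall g h, T g -> T h -> (g : X -> R) = h %[ae P] -> gamma g = gamma h,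
      pos_homogeneous T gamma &
      forall h Pt, T h -> dqm_path M h Pt ->
        t^-1 * (Psi (Pt t) - Psi P) @[t --> 0^'+] --> gamma h].

End dqm.

Section core.
Context {d : measure_display} {X : measurableType d} {R : realType}.
Variables (P : probability X R) (T : set (L2 P)) (gamma : L2 P -> R).

Definition linearity_subspace (V : set (L2 P)) :=
  [/\ subspace V, V `<=` T &
      forall a f g, V f -> V g -> gamma (a *: f + g) = a * gamma f + gamma g].

Definition Ngamma : set (L2 P) := [set h | T h /\ gamma h + gamma (- h) = 0].

Definition core : set (L2 P) :=
  [set w | Ngamma w /\
     forall v c, Ngamma v -> gamma (v + c *: w) = gamma v + c * gamma w].

Definition riesz_representer (C : set (L2 P)) (psi : L2 P) :=
  L2closure (span C) psi /\ forall h, C h -> gamma h = L2dot psi h.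

(* [xget] returns a Riesz representer, which is unique up to almost everywhere
   equality; the default value [0] is used only if there is none. *)
Definition efficiency_bound (C : set (L2 P)) : R :=
  L2norm (xget 0 (riesz_representer C)) ^+ 2.

End core.

(* The normal law with mean 0 and variance v; [normal_prob 0 0] is not the
   point mass at 0 in the library. *)
Definition centered_normal {R : realType} (v : R) :
    probability (measurableTypeR R) R :=
  if v == 0 then (\d_(0 : measurableTypeR R) : probability _ _)
  else (normal_prob 0 (Num.sqrt v) : probability _ _).

Section regular.
Context {d : measure_display} {X : measurableType d} {R : realType}.

(* The law of [Z n] under [mu n] converges weakly to [L]. *)
Definition weakly_converges (mu : forall n, probability (n.-tuple X) R)
    (Z : forall n, n.-tuple X -> R) (L : probability (measurableTypeR R) R) :=
  forall f : R -> R, continuous f -> (exists K : R, forall y, `|f y| <= K) ->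
    (\int[mu n]_x f (Z n x))%R @[n --> \oo] --> (\int[L]_y f y)%R.

Definition estimator_sequence : Type := forall n, {mfun n.-tuple X >-> R}.

Variables (M : set (probability X R)) (P : probability X R).
Variables (Psi : probability X R -> R) (T : set (L2 P)) (gamma : L2 P -> R).

Definition regular (Tn : estimator_sequence) (C : set (L2 P))
    (L : probability (measurableTypeR R) R) :=
  forall h Pt, C h -> dqm_path M h Pt ->
    let Pn n := Pt (Num.sqrt n%:R)^-1 in
    weakly_converges (fun n => iid (Pn n) n)
      (fun n x => Num.sqrt n%:R * (Tn n x - Psi (Pn n))) L.

Definition is_regular (Tn : estimator_sequence) (C : set (L2 P)) :=
  exists L, regular Tn C L.

Definition regular_cones (Tn : estimator_sequence) : set (set (L2 P)) :=
  [set C | [/\ convex_cone C, C `<=` T & is_regular Tn C]].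

Definition vbound (Tn : estimator_sequence) : \bar R :=
  ereal_sup [set (efficiency_bound gamma C)%:E | C in regular_cones Tn].

Definition efficient (Tn : estimator_sequence) (V : set (L2 P)) :=
  regular Tn V (centered_normal (efficiency_bound gamma V)).

End regular.

(* Main.v *)
(* No convolution theorem is needed: the limit laws are compared through the
   Hellinger affinity.  Since [V_V < V_V'], some direction [h] in [V'] satisfies
   [gamma(h)^2 > V_V |h|^2].  Along a path with score [h], differentiability in
   quadratic mean gives [(affinity of P^n and P_{n,h}^n)^2 --> exp(-|h|^2/4)].
   If [T_n] were [V]-efficient and regular along [V'], then
   [sqrt n (T_n - Psi P)] would tend to [N(0, V_V)] under [P^n] and to
   [N(gamma(h), V_V)] under [P_{n,h}^n], two laws whose squared affinity is
   [exp(-gamma(h)^2/(4 V_V))], which is smaller (and is [0] if [V_V = 0]).  But a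
   statistic cannot decrease affinity and weak limits cannot decrease it either:
   both facts follow from [(affinity)^2 <= E_P phi * E_Q phi^-1], applied to
   bounded continuous functions [phi] of the statistic. *)

Require Import Defs.
From HB Require Import structures.
From mathcomp Require Import all_boot all_order all_algebra.
From mathcomp Require Import all_classical all_reals all_analysis.
From mathcomp Require Import measurable_realfun ring lra.
Set Implicit Arguments.
Unset Strict Implicit.
Unset Printing Implicit Defensive.
Import Order.TTheory GRing.Theory Num.Theory.
Import numFieldNormedType.Exports.
Local Open Scope classical_set_scope.
Local Open Scope ring_scope.

Section change_of_measure.
Context {d : measure_display} {X : measurableType d} {R : realType}.

Lemma ge0_integral_density (nu : {finite_measure set X -> \bar R})
    (mu : {sigma_finite_measure set X -> \bar R}) (p f : X -> \bar R) :
  nu `<< mu -> measurable_fun setT p -> measurable_fun setT f ->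
  (forall x, 0 <= f x)%E ->
  ae_eq mu setT (Radon_Nikodym_SigmaFinite.f nu mu) p ->
  (\int[mu]_x (f x * p x) = \int[nu]_x f x)%E.
Proof.
move=> numu mp mf f0 aep.
rewrite -(Radon_Nikodym_SigmaFinite.change_of_variables numu)//.
apply: ae_eq_integral => //.
- exact: emeasurable_funM.
- apply: emeasurable_funM => //.
  exact: measurable_int (Radon_Nikodym_SigmaFinite.f_integrable _).
- exact/ae_eqe_mul2l/ae_eq_sym.
Qed.

Lemma measurable_density (Q : probability X R)
    (mu : {sigma_finite_measure set X -> \bar R}) :
  Q `<< mu -> measurable_fun setT (density Q mu).
Proof.
move=> Qmu; exact: measurableT_comp.
Qed.

Definition sqrt_density (Q : probability X R)
    (mu : {sigma_finite_measure set X -> \bar R}) (x : X) : R :=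
  Num.sqrt (density Q mu x).

Lemma measurable_sqrt_density (Q : probability X R)
    (mu : {sigma_finite_measure set X -> \bar R}) :
  Q `<< mu -> measurable_fun setT (sqrt_density Q mu).
Proof.
move=> Qmu; apply: (measurableT_comp (f := @Num.sqrt R) (g := density Q mu)).
  by apply: continuous_measurable_fun; exact: sqrt_continuous.
exact: measurable_density.
Qed.

Lemma integral_sqrt_density (Q : probability X R)
    (mu : {sigma_finite_measure set X -> \bar R}) (f : X -> R) :
  Q `<< mu -> measurable_fun setT f -> (forall x, 0 <= f x) ->
  (\int[mu]_x (f x * sqrt_density Q mu x ^+ 2)%:E = \int[Q]_x (f x)%:E)%E.
Proof.
move=> Qmu mf f0; under eq_integral do rewrite EFinM.
apply: (ge0_integral_density Qmu) => //.
- exact/measurable_EFinP/measurable_funX/measurable_sqrt_density.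
- exact/measurable_EFinP.
- have := ae_eq_Radon_Nikodym_SigmaFinite Qmu measurableT.
  apply: filterS => x /(_ I) E _; move: (E).
  have := Radon_Nikodym_SigmaFinite.f_ge0 Qmu x.
  have := Radon_Nikodym_SigmaFinite.f_fin_num Qmu x.
  rewrite E => h1 h2 _.
  by rewrite /sqrt_density /density sqr_sqrtr ?fineK// fine_ge0.
Qed.

Lemma dominates_dominatingl (Q P : probability X R) : Q `<< dominating Q P.
Proof.
apply/null_content_dominatesP => A mA.
rewrite (_ : _ A = (Q A + P A)%E); last exact: measure_addE.
move/eqP; by rewrite padde_eq0 ?measure_ge0// => /andP[/eqP].
Qed.

Lemma dominates_dominatingr (Q P : probability X R) : P `<< dominating Q P.
Proof.
apply/null_content_dominatesP => A mA.
rewrite (_ : _ A = (Q A + P A)%E); last exact: measure_addE.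
move/eqP; by rewrite padde_eq0 ?measure_ge0// => /andP[_ /eqP].
Qed.

Definition sqr_hellinger (P Q : probability X R) : \bar R :=
  let mu := dominating Q P in
  (\int[mu]_x ((sqrt_density Q mu x - sqrt_density P mu x) ^+ 2)%:E)%E.

End change_of_measure.

Section bounded_integrals.
Context {d : measure_display} {X : measurableType d} {R : realType}.
Implicit Types (P Q : probability X R) (f : X -> R).

Lemma probability_integrable P f (K : R) :
  measurable_fun setT f -> (forall x, `|f x| <= K) ->
  P.-integrable setT (EFin \o f).
Proof.
move=> mf fK; apply: measurable_bounded_integrable => //.
  by rewrite /= probability_setT ltry.
exists K; split; first exact: num_real.
by move=> y Ky x _; apply: (le_trans (fK x)); exact: ltW.
Qed.

Lemma Rintegral_probability_cst P (c : R) : (\int[P]_x c)%R = c.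
Proof. by rewrite Rintegral_cst//= probability_setT mulr1. Qed.

Lemma Rintegral_bounds P f (K : R) :
  measurable_fun setT f -> (forall x, 0 <= f x <= K) ->
  0 <= (\int[P]_x f x)%R <= K.
Proof.
move=> mf fK; rewrite Rintegral_ge0/=; last by move=> x _; case/andP: (fK x).
rewrite -[leRHS](Rintegral_probability_cst P).
apply: le_Rintegral => //.
- apply: (@probability_integrable _ _ K) => // x.
  by case/andP: (fK x) => f0 fxK; rewrite ger0_norm.
- exact: (@probability_integrable _ _ `|K|).
- by move=> x _; case/andP: (fK x).
Qed.

Lemma EFin_Rintegral P f (K : R) :
  measurable_fun setT f -> (forall x, 0 <= f x <= K) ->
  ((\int[P]_x f x)%R%:E = \int[P]_x (f x)%:E)%E.
Proof.
move=> mf fK; rewrite /Rintegral fineK//; apply: integrable_fin_num => //.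
apply: (@probability_integrable _ _ K) => // x.
by case/andP: (fK x) => x0 xK; rewrite ger0_norm.
Qed.

End bounded_integrals.

Lemma ge0_integralZl_real d (X : measurableType d) (R : realType)
    (mu : {measure set X -> \bar R}) (f : X -> R) (k : R) :
  measurable_fun setT f -> (forall x, 0 <= f x) -> 0 <= k ->
  (\int[mu]_x (k * f x)%:E = k%:E * \int[mu]_x (f x)%:E)%E.
Proof.
move=> mf f0 k0; under eq_integral do rewrite EFinM.
rewrite ge0_integralZl//; first exact/measurable_EFinP.
by move=> x _; rewrite lee_fin.
Qed.

Lemma sqr_le_mul (R : realFieldType) (s F G : R) : 0 <= F -> 0 <= G ->
  (forall lam, 0 < lam -> 2 * s <= lam * F + lam^-1 * G) ->
  0 <= s -> s ^+ 2 <= F * G.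
Proof.
move=> F0 G0 H; rewrite le_eqVlt => /predU1P[<-|s0].
  by rewrite expr0n/= mulr_ge0.
move: F0; rewrite le_eqVlt => /predU1P[F0|F0].
  have G1 : 0 < G + 1 by lra.
  have : 0 < (G + 1) / (2 * s) by rewrite divr_gt0 ?mulr_gt0.
  move/H; rewrite -F0 mulr0 add0r invf_div mulrAC ler_pdivlMr// mulrDr.
  by have := mulr_gt0 (ltr0n _ 2) s0; lra.
have := H _ (divr_gt0 s0 F0); rewrite divfK ?gt_eqF// invf_div => h.
have {}h : s <= F / s * G by lra.
by move: h; rewrite mulrAC ler_pdivlMr// -expr2.
Qed.

Section affinity.
Context {d : measure_display} {X : measurableType d} {R : realType}.
Implicit Types (P Q : probability X R) (phi psi : X -> R).

(* Integrates [2 c p q <= lam phi p^2 + psi q^2 / lam], which is AM-GM, for the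
   square roots [p] and [q] of the densities of [P] and [Q]. *)
Lemma sqr_hellinger_amgm P Q phi psi (K lam A c : R) : 0 < lam ->
  measurable_fun setT phi -> (forall x, 0 <= phi x <= K) ->
  measurable_fun setT psi -> (forall x, 0 <= psi x <= K) ->
  0 <= c -> (forall x, c ^+ 2 <= phi x * psi x) ->
  (sqr_hellinger P Q <= A%:E)%E ->
  c * (2 - A) <= lam * (\int[P]_x phi x)%R + lam^-1 * (\int[Q]_x psi x)%R.
Proof.
move=> l0 mphi phiK mpsi psiK c0 cphi HA.
pose mu := dominating Q P.
pose p := sqrt_density P mu; pose q := sqrt_density Q mu.
have mp : measurable_fun setT p.
  exact/measurable_sqrt_density/dominates_dominatingr.
have mq : measurable_fun setT q.
  exact/measurable_sqrt_density/dominates_dominatingl.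
have phi0 x : 0 <= phi x by case/andP: (phiK x).
have psi0 x : 0 <= psi x by case/andP: (psiK x).
have pt x : c * p x ^+ 2 + c * q x ^+ 2 <=
    lam * phi x * p x ^+ 2 + lam^-1 * psi x * q x ^+ 2 +
      c * (q x - p x) ^+ 2.
  suff : c * (2 * (p x * q x)) <=
      lam * phi x * p x ^+ 2 + lam^-1 * psi x * q x ^+ 2 by lra.
  have p0 : 0 <= p x by rewrite /p /sqrt_density sqrtr_ge0.
  have q0 : 0 <= q x by rewrite /q /sqrt_density sqrtr_ge0.
  have lphi : 0 <= lam * phi x by apply: mulr_ge0 => //; exact: ltW.
  have lpsi : 0 <= lam^-1 * psi x.
    by apply: mulr_ge0 => //; rewrite invr_ge0 ltW.
  have cs : c <= Num.sqrt (lam * phi x) * Num.sqrt (lam^-1 * psi x).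
    rewrite -(ler_pXn2r (n := 2))// ?nnegrE// ?mulr_ge0 ?sqrtr_ge0//.
    by rewrite exprMn !sqr_sqrtr// mulrACA divff ?gt_eqF// mul1r.
  apply: (@le_trans _ _ (Num.sqrt (lam * phi x) * Num.sqrt (lam^-1 * psi x)
     * (2 * (p x * q x)))).
    by rewrite ler_wpM2r// !mulr_ge0.
  rewrite -{2}(sqr_sqrtr lphi) -{2}(sqr_sqrtr lpsi) -subr_ge0.
  set a := Num.sqrt _; set b := Num.sqrt _.
  rewrite (_ : _ - _ = (a * p x - b * q x) ^+ 2) ?sqr_ge0//; ring.
have intP phi' : measurable_fun setT phi' -> (forall x, 0 <= phi' x) ->
    (\int[mu]_x (phi' x * p x ^+ 2)%:E = \int[P]_x (phi' x)%:E)%E.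
  by move=> *; apply: integral_sqrt_density => //; exact: dominates_dominatingr.
have intQ phi' : measurable_fun setT phi' -> (forall x, 0 <= phi' x) ->
    (\int[mu]_x (phi' x * q x ^+ 2)%:E = \int[Q]_x (phi' x)%:E)%E.
  by move=> *; apply: integral_sqrt_density => //; exact: dominates_dominatingl.
have mM (f r : X -> R) : measurable_fun setT f -> measurable_fun setT r ->
    measurable_fun setT (fun x => (f x * r x ^+ 2)%:E).
  move=> mf mr; apply/measurable_EFinP/measurable_funM => //.
  exact: measurable_funX.
have mcst : measurable_fun setT (cst c : X -> R) by [].
have mphi' : measurable_fun setT (fun x => lam * phi x).
  exact: measurable_funM.
have mpsi' : measurable_fun setT (fun x => lam^-1 * psi x).
  exact: measurable_funM.
have mpq : measurable_fun setT (fun x => q x - p x) by exact: measurable_funB.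
have g0 (f r : X -> R) x : (forall x, 0 <= f x) -> (0 <= (f x * r x ^+ 2 : R)%:E)%E.
  by move=> f0; rewrite lee_fin mulr_ge0 ?sqr_ge0.
have phi'0 x : 0 <= lam * phi x by apply: mulr_ge0 => //; exact: ltW.
have psi'0 x : 0 <= lam^-1 * psi x.
  by apply: mulr_ge0 => //; rewrite invr_ge0 ltW.
have le : ((c + c)%:E <= lam%:E * (\int[P]_x phi x)%R%:E +
    lam^-1%:E * (\int[Q]_x psi x)%R%:E + c%:E * A%:E)%E.
  apply: (@le_trans _ _ (\int[mu]_x
      (c * p x ^+ 2 + c * q x ^+ 2)%:E)%E).
    under eq_integral do rewrite EFinD.
    rewrite ge0_integralD//=; [|by move=> x _; exact: (g0 (cst c))
      |exact: (mM (cst c))|by move=> x _; exact: (g0 (cst c))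
      |exact: (mM (cst c))].
    by rewrite (intP (cst c)) ?(intQ (cst c))//= !integral_cst//=
        !probability_setT !mule1.
  apply: (@le_trans _ _ (\int[mu]_x ((lam * phi x * p x ^+ 2)%:E +
      (lam^-1 * psi x * q x ^+ 2)%:E + (c * (q x - p x) ^+ 2)%:E))%E).
    apply: ge0_le_integral => //=.
    - by move=> x _; rewrite EFinD adde_ge0//; exact: (g0 (cst c)).
    - under eq_fun do rewrite EFinD.
      by apply: emeasurable_funD; exact: (mM (cst c)).
    - apply: emeasurable_funD; last exact: (mM (cst c)).
      by apply: emeasurable_funD; exact: mM.
    - by move=> x _; rewrite -!EFinD lee_fin.
  rewrite ge0_integralD//=; last 4 first.
  - by move=> x _; apply: adde_ge0; [exact: (g0 (fun x => lam * phi x))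
      |exact: (g0 (fun x => lam^-1 * psi x))].
  - by apply: emeasurable_funD; exact: mM.
  - by move=> x _; exact: (g0 (cst c) (fun x => q x - p x)).
  - exact: (mM (cst c)).
  rewrite ge0_integralD//=; last 4 first.
  - by move=> x _; exact: (g0 (fun x => lam * phi x)).
  - exact: mM.
  - by move=> x _; exact: (g0 (fun x => lam^-1 * psi x)).
  - exact: mM.
  rewrite intP// intQ// (EFin_Rintegral P mphi phiK) (EFin_Rintegral Q mpsi psiK).
  rewrite !ge0_integralZl_real//; [|exact: measurable_funX
    |by move=> x; rewrite sqr_ge0|by rewrite invr_ge0 ltW|exact: ltW].
  by rewrite leeD2l// lee_wpmul2l.
move: le; rewrite -!EFinM -!EFinD lee_fin; lra.
Qed.

Lemma sqr_hellinger_affinity P Q phi psi (K A c : R) :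
  measurable_fun setT phi -> (forall x, 0 <= phi x <= K) ->
  measurable_fun setT psi -> (forall x, 0 <= psi x <= K) ->
  0 <= c -> (forall x, c ^+ 2 <= phi x * psi x) ->
  (sqr_hellinger P Q <= A%:E)%E -> A <= 2 ->
  (c * (1 - A / 2)) ^+ 2 <= (\int[P]_x phi x)%R * (\int[Q]_x psi x)%R.
Proof.
move=> mphi phiK mpsi psiK c0 cphi HA A2.
have /andP[F0 _] := Rintegral_bounds P mphi phiK.
have /andP[G0 _] := Rintegral_bounds Q mpsi psiK.
apply: sqr_le_mul => //; last by rewrite mulr_ge0//; lra.
move=> lam l0.
have := sqr_hellinger_amgm l0 mphi phiK mpsi psiK c0 cphi HA.
by rewrite (_ : c * (2 - A) = 2 * (c * (1 - A / 2)))//; field.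
Qed.

End affinity.

Section iid_affinity.
Context {d : measure_display} {X : measurableType d} {R : realType}.
Implicit Types P Q : probability X R.

Lemma measurable_cons_section n (f : n.+1.-tuple X -> R) (x : X) :
  measurable_fun setT f ->
  measurable_fun setT (fun y : n.-tuple X => f (consT (x, y))).
Proof.
move=> mf; apply: (measurableT_comp mf).
apply: (measurableT_comp (@measurable_consT _ X n)).
exact: measurable_pair1.
Qed.

Lemma measurable_iid_section P n (f : n.+1.-tuple X -> R) (K : R) :
  measurable_fun setT f -> (forall z, 0 <= f z <= K) ->
  measurable_fun setT (fun x => (\int[iid P n]_y f (consT (x, y)))%R).
Proof.
move=> mf fK; apply/measurable_EFinP.
rewrite (_ : _ \o _ =
    fubini_F (iid P n) (fun z => (f (consT z))%:E)); last first.
  apply/funext => x /=; rewrite /fubini_F (@EFin_Rintegral _ _ _ _ _ K)//.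
  exact: measurable_cons_section.
apply: measurable_fun_fubini_tonelli_F.
  apply/measurable_EFinP/(measurableT_comp mf).
  exact: measurable_consT.
by move=> z; rewrite lee_fin; case/andP: (fK (consT z)).
Qed.

Lemma Rintegral_iidS P n (f : n.+1.-tuple X -> R) (K : R) :
  measurable_fun setT f -> (forall z, 0 <= f z <= K) ->
  (\int[iid P n.+1]_z f z)%R =
  (\int[P]_x (\int[iid P n]_y f (consT (x, y))))%R.
Proof.
move=> mf fK; have f0 z : 0 <= f z by case/andP: (fK z).
congr fine; rewrite [LHS]ge0_integral_pushforward//=.
- rewrite fubini_tonelli1//=.
  + apply: eq_integral => x _; rewrite /fubini_F (@EFin_Rintegral _ _ _ _ _ K)//.
    exact: measurable_cons_section.
  + by apply/measurable_EFinP; apply: (measurableT_comp mf); exact: measurable_consT.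
  + by move=> z; rewrite lee_fin.
- exact/measurable_EFinP.
- by move=> z _; rewrite lee_fin.
Qed.

(* The affinity of product measures is at least multiplicative: integrating
   out all coordinates but one turns [phi] and [psi] into test functions of a
   single observation, with [c] multiplied by the affinity of the others. *)
Lemma iid_affinity P Q n (phi psi : n.-tuple X -> R) (K A c : R) :
  measurable_fun setT phi -> (forall x, 0 <= phi x <= K) ->
  measurable_fun setT psi -> (forall x, 0 <= psi x <= K) ->
  0 <= c -> (forall x, c ^+ 2 <= phi x * psi x) ->
  (sqr_hellinger P Q <= A%:E)%E -> A <= 2 ->
  (c * (1 - A / 2) ^+ n) ^+ 2 <=
  (\int[iid P n]_x phi x)%R * (\int[iid Q n]_x psi x)%R.
Proof.
move=> + + + + c0 + HA A2; elim: n phi psi => [|n IH] phi psi mphi phiK mpsi psiK cpp.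
  rewrite mulr1 /Rintegral !integral_dirac//=; [|exact/measurable_EFinP..].
  by rewrite !indicE !in_setT !mul1r.
rewrite (Rintegral_iidS _ mphi phiK) (Rintegral_iidS _ mpsi psiK).
rewrite [_ ^+ n.+1]exprSr mulrA; apply: (@sqr_hellinger_affinity _ _ _ _ _ _ _ K) => //.
- exact: measurable_iid_section.
- by move=> x; apply: Rintegral_bounds => //; exact: measurable_cons_section.
- exact: measurable_iid_section.
- by move=> x; apply: Rintegral_bounds => //; exact: measurable_cons_section.
- by rewrite mulr_ge0// exprn_ge0//; lra.
- by move=> x; apply: IH => //; exact: measurable_cons_section.
Qed.

End iid_affinity.

Section dqm_hellinger.
Context {d : measure_display} {X : measurableType d} {R : realType}.
Implicit Types P Q : probability X R.

Lemma measurable_L2 P (h : L2 P) : measurable_fun setT h.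
Proof. exact: measurable_funP. Qed.

Lemma L2_integrable_sqr P (h : L2 P) :
  P.-integrable setT (EFin \o (fun x => h x ^+ 2)).
Proof. exact: Lfun2_integrable_sqr (LfunP h). Qed.

Lemma EFin_L2_sqr P (h : L2 P) :
  ((\int[P]_x (h x ^+ 2))%R%:E = \int[P]_x (h x ^+ 2)%:E)%E.
Proof. by rewrite /Rintegral fineK//; exact/integrable_fin_num/L2_integrable_sqr. Qed.

Lemma sqr_hellinger_le_dqm P Q (t : R) (h : L2 P) (delta : R) :
  t != 0 -> 0 < delta ->
  (sqr_hellinger P Q <= (t ^+ 2 * (1 + delta) / 4 *
     (\int[P]_x (h x ^+ 2))%R)%:E +
     (t ^+ 2 * (1 + delta^-1))%:E * dqm_remainder Q t h)%E.
Proof.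
move=> t0 d0; rewrite EFinM EFin_L2_sqr.
pose mu := dominating Q P.
pose p := sqrt_density P mu; pose q := sqrt_density Q mu.
have mp : measurable_fun setT p.
  exact/measurable_sqrt_density/dominates_dominatingr.
have mq : measurable_fun setT q.
  exact/measurable_sqrt_density/dominates_dominatingl.
have mh2 : measurable_fun setT (fun x => h x ^+ 2).
  exact/measurable_funX/measurable_L2.
have mhp : measurable_fun setT (fun x => h x ^+ 2 * p x ^+ 2).
  by apply: measurable_funM => //; exact: measurable_funX.
pose r x := (q x - p x) / t - 2^-1 * h x * p x.
have mr : measurable_fun setT r.
  apply: measurable_funB.
    by apply: measurable_funM => //; exact: measurable_funB.
  by apply: measurable_funM => //; apply: measurable_funM => //; exact: measurable_L2.
have k1 : 0 <= t ^+ 2 * (1 + delta) / 4.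
  by rewrite -mulrA mulr_ge0 ?sqr_ge0//; lra.
have di : 0 < delta^-1 by rewrite invr_gt0.
have k2 : 0 <= t ^+ 2 * (1 + delta^-1).
  by rewrite mulr_ge0 ?sqr_ge0//; lra.
have mr2 : measurable_fun setT (fun x => r x ^+ 2) by exact: measurable_funX.
have hp0 x : 0 <= h x ^+ 2 * p x ^+ 2 by rewrite mulr_ge0 ?sqr_ge0.
have r0 x : 0 <= r x ^+ 2 by rewrite sqr_ge0.
rewrite -(integral_sqrt_density (@dominates_dominatingr _ _ _ Q P))//; last first.
  by move=> x; rewrite sqr_ge0.
rewrite (_ : dqm_remainder Q t h = \int[mu]_x (r x ^+ 2)%:E)%E//.
rewrite -[X in (X * _ + _)%E]/(_%:E) -!(ge0_integralZl_real mu)//.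
rewrite -ge0_integralD//=; last 4 first.
- by move=> x _; rewrite lee_fin mulr_ge0.
- by apply/measurable_EFinP/measurable_funM.
- by move=> x _; rewrite lee_fin mulr_ge0.
- by apply/measurable_EFinP/measurable_funM.
apply: ge0_le_integral => //=.
- by move=> x _; rewrite lee_fin sqr_ge0.
- by apply/measurable_EFinP/measurable_funX/measurable_funB.
- by apply: emeasurable_funD; apply/measurable_EFinP/measurable_funM.
move=> x _; rewrite -EFinD lee_fin.
have -> : sqrt_density Q (dominating Q P) x - sqrt_density P (dominating Q P) x
    = t * (r x + 2^-1 * h x * p x).
  by rewrite /r subrK mulrC divfK.
rewrite -/mu -/p.
set a := r x; set b := h x; set c := p x.
(* (u + w)^2 <= (1 + delta) w^2 + (1 + delta^-1) u^2 *)
rewrite -subr_ge0 (_ : _ - _ =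
  t ^+ 2 * delta * (2^-1 * b * c - delta^-1 * a) ^+ 2); last first.
  by field; rewrite gt_eqF.
by rewrite mulr_ge0 ?sqr_ge0// mulr_ge0 ?sqr_ge0// ltW.
Qed.

Lemma dqm_sqr_hellinger M P (h : L2 P) (Pt : R -> probability X R) (B : R) :
  dqm_path M h Pt -> (\int[P]_x (h x ^+ 2))%R / 4 < B ->
  \forall t \near 0^'+, (sqr_hellinger P (Pt t) <= (t ^+ 2 * B)%:E)%E.
Proof.
case=> _ _ Hrem HB.
set H := (\int[P]_x (h x ^+ 2))%R in HB.
have H0 : 0 <= H by apply: Rintegral_ge0 => x _; rewrite sqr_ge0.
pose e := (B - H / 4) / 2.
have e0 : 0 < e by rewrite /e; lra.
pose delta := e / (H + 1).
have d0 : 0 < delta by rewrite divr_gt0//; lra.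
have di0 : 0 < delta^-1 by rewrite invr_gt0.
pose eta := e / (1 + delta^-1).
have eta0 : 0 < eta by rewrite divr_gt0//; lra.
have near_rem : \forall t \near 0^'+, (dqm_remainder (Pt t) t h < eta%:E)%E.
  have : nbhs 0%E [set y : \bar R | (y < eta%:E)%E].
    by apply: open_nbhs_nbhs; split; [exact: open_ereal_lt_ereal|rewrite /= lte_fin].
  by move/Hrem.
near=> t.
have t0 : 0 < t by near: t; exact: nbhs_right_gt.
have rt : (dqm_remainder (Pt t) t h <= eta%:E)%E by apply: ltW; near: t.
have tn0 : t != 0 by rewrite gt_eqF.
apply: (le_trans (sqr_hellinger_le_dqm _ h tn0 d0)).
apply: (@le_trans _ _ ((t ^+ 2 * (1 + delta) / 4 * H)%:E +
   (t ^+ 2 * (1 + delta^-1))%:E * eta%:E)%E).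
  by rewrite leeD2l// lee_wpmul2l// lee_fin mulr_ge0 ?sqr_ge0//; lra.
have eE : (1 + delta^-1) * eta = e by rewrite /eta mulrC divfK//; lra.
have dE : delta * (H + 1) = e by rewrite /delta divfK//; lra.
rewrite -EFinM -EFinD lee_fin -(mulrA _ _ eta) eE.
rewrite (_ : t ^+ 2 * _ / _ * _ + _ = t ^+ 2 * ((1 + delta) / 4 * H + e)); last by field.
rewrite ler_wpM2l ?sqr_ge0//.
have : B = H / 4 + 2 * e by rewrite /e; lra.
lra.
Unshelve. all: by end_near.
Qed.

End dqm_hellinger.

Section exponential_tests.
Context {R : realType}.
Implicit Types (a b k x y c s : R).

Definition clip k y := Num.max (- k) (Num.min k y).

Lemma clip_bounds k y : 0 <= k -> - k <= clip k y <= k.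
Proof.
by move=> k0; rewrite /clip le_max lexx/= ge_max ge_min lexx/= andbT; lra.
Qed.

Lemma clip_lip k x y : clip k x <= clip k y + `|x - y|.
Proof.
rewrite /clip.
have := ler_norm (x - y); have := normr_ge0 (x - y).
by rewrite /Num.max /Num.min; repeat case: ifPn; rewrite -?leNgt; lra.
Qed.

Lemma continuous_clip k : continuous (clip k).
Proof.
move=> y; apply: (@continuous_max R R (cst (- k)) (fun y => Num.min k y)).
  exact: cvg_cst.
by apply: (@continuous_min R R (cst k) id); [exact: cvg_cst|exact: cvg_id].
Qed.

(* [exp_test] is a truncation of the square root of the likelihood ratio of two
   normal laws with the same variance, the test function for which
   [weak_limit_affinity] is sharp. *)
Definition exp_test a b k y := expR (clip k (a * y + b)).

Definition exp_testV a b k y := expR (- clip k (a * y + b)).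

Lemma exp_testM a b k y : exp_test a b k y * exp_testV a b k y = 1.
Proof. by rewrite /exp_test /exp_testV -expRD subrr expR0. Qed.

Lemma exp_test_bounds a b k y : 0 <= k -> 0 <= exp_test a b k y <= expR k.
Proof.
by move=> k0; rewrite expR_ge0 ler_expR; case/andP: (clip_bounds (a * y + b) k0).
Qed.

Lemma exp_testV_bounds a b k y : 0 <= k -> 0 <= exp_testV a b k y <= expR k.
Proof.
move=> k0; rewrite expR_ge0 ler_expR lerNl.
by case/andP: (clip_bounds (a * y + b) k0).
Qed.

Lemma continuous_clip_affine a b k : continuous (fun y => clip k (a * y + b)).
Proof.
move=> y; apply: (continuous_comp (f := fun y => a * y + b)).
  apply: (@cvgD _ R^o); last exact: cvg_cst.
  by apply: cvgM; [exact: cvg_cst|exact: cvg_id].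
exact: continuous_clip.
Qed.

Lemma continuous_exp_test a b k : continuous (exp_test a b k).
Proof.
move=> y; apply: (continuous_comp (f := fun y => clip k (a * y + b))).
  exact: continuous_clip_affine.
exact: continuous_expR.
Qed.

Lemma continuous_exp_testV a b k : continuous (exp_testV a b k).
Proof.
move=> y; apply: (continuous_comp (f := fun y => - clip k (a * y + b))).
  by apply: (@cvgN _ R^o); exact: continuous_clip_affine.
exact: continuous_expR.
Qed.

Lemma exp_testV_shift a b k y c s :
  exp_testV a b k (y + s) <=
  expR (`|a| * `|s - c|) * exp_testV a (a * c + b) k y.
Proof.
rewrite /exp_testV -expRD ler_expR lerNl opprD opprK addrC lerBlDr.
have := clip_lip k (a * y + (a * c + b)) (a * (y + s) + b).
rewrite (_ : _ - _ = a * (c - s)); last by ring.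
by rewrite normrM distrC.
Qed.

End exponential_tests.

Lemma expR_le_onem (R : realType) (x : R) : 0 <= x -> x < 1 ->
  expR (- (x / (1 - x))) <= 1 - x.
Proof.
move=> x0 x1; have x1' : 0 < 1 - x by lra.
rewrite expRN -[leRHS]invrK lef_pV2 ?posrE ?invr_gt0 ?expR_gt0//.
apply: le_trans (expR_ge1Dx _).
have x1n : 1 - x != 0 by rewrite gt_eqF.
by rewrite [leLHS](_ : _ = 1 + x / (1 - x))//; field.
Qed.

Lemma expR_le_onemX (R : realType) (B B' : R) : 0 <= B -> B < B' ->
  \forall n \near \oo, expR (- B') <= (1 - B / n%:R / 2) ^+ n ^+ 2.
Proof.
move=> B0 BB'; have B'0 : 0 < B' by lra.
pose e := (1 - B / B') / 2.
have BB'1 : B / B' < 1 by rewrite ltr_pdivrMr// mul1r.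
have BB'0 : 0 <= B / B' by rewrite divr_ge0// ltW.
have e0 : 0 < e by rewrite /e; lra.
near=> n.
have n0 : 0 < n%:R :> R by near: n; exact: nbhs_infty_gtr.
pose x := B / n%:R / 2.
have x0 : 0 <= x by rewrite !divr_ge0// ltW.
have xe : x <= e.
  rewrite /x mulrAC ler_pdivrMr// [leRHS]mulrC -ler_pdivrMr//.
  by near: n; exact: nbhs_infty_ger.
have x1 : x < 1 by apply: (le_lt_trans xe); rewrite /e; lra.
have x1' : 0 < 1 - x by lra.
apply: (@le_trans _ _ (expR (- (x / (1 - x))) ^+ n ^+ 2)).
  rewrite -exprM -expRM_natl ler_expR natrM mulrN lerN2.
  rewrite mulrA ler_pdivrMr// (_ : n%:R * 2 * x = B); last first.
    by rewrite /x; field; rewrite gt_eqF.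
  rewrite -ler_pdivrMl// mulrC; apply: (@le_trans _ _ (1 - e)); last by lra.
  by rewrite /e; lra.
rewrite -!exprM lerXn2r ?nnegrE ?expR_ge0//; last exact: expR_le_onem.
exact: ltW.
Unshelve. all: by end_near.
Qed.

Lemma cvg_invsqrt_at_right (R : realType) :
  (Num.sqrt n%:R)^-1 @[n --> \oo] --> (0 : R)^'+.
Proof.
move=> A [e /= e0 H].
have ei : 0 < e^-1 by rewrite invr_gt0.
suff : \forall n \near \oo, A (Num.sqrt n%:R)^-1 by [].
near=> n.
have n0 : 0 < Num.sqrt n%:R :> R.
  by rewrite sqrtr_gt0; near: n; exact: nbhs_infty_gtr.
apply: H => /=; last by rewrite invr_gt0.
rewrite sub0r normrN gtr0_norm ?invr_gt0// invf_plt ?posrE//.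
rewrite -(ltr_pXn2r (n := 2)) ?nnegrE ?ltW// sqr_sqrtr ?ler0n//.
by near: n; exact: nbhs_infty_gtr.
Unshelve. all: by end_near.
Qed.

Section weak_limit.
Context {d : measure_display} {X : measurableType d} {R : realType}.
Variables (M : set (probability X R)) (P : probability X R).
Variables (Psi : probability X R -> R) (Tn : @estimator_sequence _ X R).

Let meas (f : R -> R) n (u v : R) : continuous f ->
  measurable_fun setT (fun x : n.-tuple X => f (u * (Tn n x - v))).
Proof.
move=> cf; apply: measurableT_comp; first exact: continuous_measurable_fun.
by apply: measurable_funM => //; apply: measurable_funB.
Qed.

Lemma weak_limit_affinity (h : L2 P) (Pt : R -> probability X R)
    (L L' : probability (measurableTypeR R) R) (B c a b k : R) :
  dqm_path M h Pt -> (\int[P]_x (h x ^+ 2))%R / 4 < B -> 0 <= k ->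
  let Qn n := Pt (Num.sqrt n%:R)^-1 in
  weakly_converges (fun n => iid P n)
    (fun n x => Num.sqrt n%:R * (Tn n x - Psi P)) L ->
  weakly_converges (fun n => iid (Qn n) n)
    (fun n x => Num.sqrt n%:R * (Tn n x - Psi (Qn n))) L' ->
  Num.sqrt n%:R * (Psi (Qn n) - Psi P) @[n --> \oo] --> c ->
  expR (- B) <= (\int[L]_y exp_test a b k y)%R *
                (\int[L']_y exp_testV a (a * c + b) k y)%R.
Proof.
move=> hPt HB k0 Qn HL HL' Hc.
pose B1 := ((\int[P]_x (h x ^+ 2))%R / 4 + B) / 2.
have H0 : 0 <= (\int[P]_x (h x ^+ 2))%R.
  by apply: Rintegral_ge0 => x _; rewrite sqr_ge0.
pose s n := Num.sqrt n%:R * (Psi (Qn n) - Psi P).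
pose FL n := (\int[iid P n]_x
  exp_test a b k (Num.sqrt n%:R * (Tn n x - Psi P)))%R.
pose FL' n := (\int[iid (Qn n) n]_x
  exp_testV a (a * c + b) k (Num.sqrt n%:R * (Tn n x - Psi (Qn n))))%R.
have cFL : FL n @[n --> \oo] --> (\int[L]_y exp_test a b k y)%R.
  apply: HL; first exact: continuous_exp_test.
  exists (expR k) => y; have /andP[y0 yk] := exp_test_bounds a b y k0.
  by rewrite ger0_norm.
have cFL' : FL' n @[n --> \oo] --> (\int[L']_y exp_testV a (a * c + b) k y)%R.
  apply: HL'; first exact: continuous_exp_testV.
  exists (expR k) => y; have /andP[y0 yk] := exp_testV_bounds a (a * c + b) y k0.
  by rewrite ger0_norm.
have ce : expR (`|a| * `|s n - c|) @[n --> \oo] --> (1 : R).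
  rewrite -(expR0 R); apply: (continuous_cvg _ (@continuous_expR R 0)).
  rewrite -(mulr0 `|a|); apply: cvgM; first exact: cvg_cst.
  rewrite -(normr0 R) -(subrr c); apply: cvg_norm.
  by apply: cvgB => //; exact: cvg_cst.
have cG : FL n * (expR (`|a| * `|s n - c|) * FL' n) @[n --> \oo] -->
   (\int[L]_y exp_test a b k y)%R *
   (1 * (\int[L']_y exp_testV a (a * c + b) k y)%R).
  by apply: cvgM => //; apply: cvgM.
rewrite -[X in _ <= _ * X]mul1r; apply: (cvgr_to_ge cG).
have nearH : \forall n \near \oo,
    (sqr_hellinger P (Qn n) <= ((Num.sqrt n%:R)^-1 ^+ 2 * B1)%:E)%E.
  have HB1 : (\int[P]_x (h x ^+ 2))%R / 4 < B1 by rewrite /B1; lra.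
  exact: (@cvg_invsqrt_at_right R _ (dqm_sqr_hellinger hPt HB1)).
near=> n.
have n0 : 0 < n%:R :> R by near: n; exact: nbhs_infty_gtr.
have HQ : (sqr_hellinger P (Qn n) <= (B1 / n%:R)%:E)%E.
  have : (sqr_hellinger P (Qn n) <= ((Num.sqrt n%:R)^-1 ^+ 2 * B1)%:E)%E.
    by near: n.
  by rewrite exprVn sqr_sqrtr ?ler0n// mulrC.
apply: (@le_trans _ _ ((1 - B1 / n%:R / 2) ^+ n ^+ 2)).
  by near: n; apply: expR_le_onemX; rewrite /B1; lra.
rewrite -[X in X ^+ 2]mul1r.
have step : (\int[iid (Qn n) n]_x
     exp_testV a b k (Num.sqrt n%:R * (Tn n x - Psi P)))%R <=
     expR (`|a| * `|s n - c|) * FL' n.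
  rewrite /FL' -RintegralZl//; last first.
    apply: (@probability_integrable _ _ _ _ _ (expR k)).
      by apply: meas; exact: continuous_exp_testV.
    move=> x; have /andP[y0 yk] := exp_testV_bounds a (a * c + b)
      (Num.sqrt n%:R * (Tn n x - Psi (Qn n))) k0.
    by rewrite ger0_norm.
  apply: le_Rintegral => //.
  - apply: (@probability_integrable _ _ _ _ _ (expR k)).
      by apply: meas; exact: continuous_exp_testV.
    move=> x; have /andP[y0 yk] := exp_testV_bounds a b
      (Num.sqrt n%:R * (Tn n x - Psi P)) k0.
    by rewrite ger0_norm.
  - apply: (@probability_integrable _ _ _ _ _
      (expR (`|a| * `|s n - c|) * expR k)).
      apply: measurable_funM => //.
      by apply: meas; exact: continuous_exp_testV.
    move=> x; have /andP[y0 yk] := exp_testV_bounds a (a * c + b)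
      (Num.sqrt n%:R * (Tn n x - Psi (Qn n))) k0.
    by rewrite ger0_norm ?mulr_ge0 ?expR_ge0// ler_wpM2l ?expR_ge0.
  - move=> x _; apply: le_trans (exp_testV_shift _ _ _ _ _ (s n)).
    by rewrite /s -mulrDr addrA subrK.
apply: le_trans (ler_wpM2l _ step); last first.
  by apply: Rintegral_ge0 => x _; exact: expR_ge0.
apply: (@iid_affinity _ _ _ _ _ _ _ _ (expR k)) => //.
- by apply: meas; exact: continuous_exp_test.
- by move=> x; exact: exp_test_bounds.
- by apply: meas; exact: continuous_exp_testV.
- by move=> x; exact: exp_testV_bounds.
- by move=> x; rewrite exp_testM expr1n.
- rewrite ler_pdivrMr//.
  by near: n; apply: filterS (nbhs_infty_gtr (B1 / 2)) => n; lra.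
Unshelve. all: by end_near.
Qed.

End weak_limit.

Section normal_tests.
Context {R : realType}.
Implicit Types (a b c k s u v w y : R).

Lemma exp_test_le a b k y : 0 <= k ->
  exp_test a b k y <= expR (a * y + b) + expR (- k).
Proof.
move=> k0; have := expR_ge0 (a * y + b); have := expR_ge0 (- k).
rewrite /exp_test /clip; set z := a * y + b => h1 h2.
have [zk|zk] := leP z k; last first.
  rewrite max_r; last lra.
  by have : expR k <= expR z; [rewrite ler_expR ltW|lra].
by have [|] := leP (- k) z => _; lra.
Qed.

Lemma exp_testV_le a b k y : 0 <= k ->
  exp_testV a b k y <= expR (- a * y - b) + expR (- k).
Proof.
move=> k0; have -> : exp_testV a b k y = exp_test (- a) (- b) k y; last exact: exp_test_le.
rewrite /exp_test /exp_testV /clip mulNr -opprD; set z := a * y + b.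
by congr expR; rewrite /Num.max /Num.min; repeat case: ifPn; rewrite -?leNgt; lra.
Qed.

Lemma ge0_integral_normal s (f : R -> R) : 
  measurable_fun setT f -> (forall y, 0 <= f y) ->
  (\int[normal_prob 0 s]_y (f y)%:E =
   \int[lebesgue_measure]_y (f y * normal_pdf 0 s y)%:E)%E.
Proof.
move=> mf f0; under [RHS]eq_integral do rewrite EFinM.
have dom := normal_prob_dominates (0 : R) s.
have mpdf : measurable_fun setT (EFin \o normal_pdf 0 s).
  by apply/measurable_EFinP; exact: measurable_normal_pdf.
rewrite -(@ge0_integral_density _ _ _ (normal_prob 0 s) lebesgue_measure (EFin \o normal_pdf 0 s))//=.
- exact/measurable_EFinP.
- apply: integral_ae_eq => //.
  + exact: Radon_Nikodym_SigmaFinite.f_integrable.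
  + by move=> E _ mE; rewrite -Radon_Nikodym_SigmaFinite.f_integral.
Qed.

Lemma integral_expR_normal s u w : s != 0 ->
  (\int[normal_prob 0 s]_y (expR (u * y + w))%:E =
   (expR (w + u ^+ 2 * s ^+ 2 / 2))%:E)%E.
Proof.
move=> s0.
have mexp : measurable_fun setT (fun y : R => expR (u * y + w)).
  by apply: measurableT_comp => //; exact: measurable_funD.
rewrite ge0_integral_normal//.
transitivity (\int[lebesgue_measure]_y
    (expR (w + u ^+ 2 * s ^+ 2 / 2) * normal_pdf (u * s ^+ 2) s y)%:E)%E.
  apply: eq_integral => y _; rewrite !normal_pdfE// /normal_fun.
  rewrite mulrCA [in RHS]mulrCA -!expRD; congr (_ * expR _)%:E.
  by field.
rewrite ge0_integralZl_real//.
- by rewrite integral_normal_pdf mule1.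
- exact: measurable_normal_pdf.
- by move=> y; exact: normal_pdf_ge0.
Qed.

Lemma Rintegral_normal_le s u w k (f : R -> R) K : s != 0 ->
  continuous f -> (forall y, 0 <= f y <= K) ->
  (forall y, f y <= expR (u * y + w) + expR (- k)) ->
  (\int[normal_prob 0 s]_y f y)%R <=
  expR (w + u ^+ 2 * s ^+ 2 / 2) + expR (- k).
Proof.
move=> s0 cf fK fle.
have mf : measurable_fun setT f by exact: continuous_measurable_fun.
have mexp : measurable_fun setT (fun y : R => expR (u * y + w)).
  by apply: measurableT_comp => //; exact: measurable_funD.
rewrite -lee_fin (EFin_Rintegral (normal_prob 0 s) mf fK).
apply: (@le_trans _ _ (\int[normal_prob 0 s]_y
   ((expR (u * y + w))%:E + (expR (- k))%:E))%E).
  apply: ge0_le_integral => //=.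
  - by move=> y _; rewrite lee_fin; case/andP: (fK y).
  - exact/measurable_EFinP.
  - by apply/measurable_EFinP/measurable_funD.
  - by move=> y _; rewrite -EFinD lee_fin.
rewrite ge0_integralD//=.
- rewrite integral_expR_normal// integral_cst//=.
  by rewrite probability_setT mule1.
- exact/measurable_EFinP.
Qed.

Lemma centered_normal_affinity v c B : 0 < B -> v * (4 * B) < c ^+ 2 -> 0 <= v ->
  exists a b k, 0 <= k /\
  (\int[centered_normal v]_y exp_test a b k y)%R *
  (\int[centered_normal v]_y exp_testV a (a * c + b) k y)%R < expR (- B).
Proof.
move=> B0 Bc; rewrite le_eqVlt => /predU1P[v0|v0].
  have c0 : c != 0 by apply/eqP => c0; move: Bc; rewrite -v0 c0 expr0n/= mul0r ltxx.
  exists (2 * B / c), (- B), B; split; first exact: ltW.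
  rewrite /centered_normal -v0 eqxx /Rintegral.
  rewrite !integral_dirac//=; last 2 first.
  - apply/measurable_EFinP; apply: continuous_measurable_fun.
    exact: continuous_exp_testV.
  - apply/measurable_EFinP; apply: continuous_measurable_fun.
    exact: continuous_exp_test.
  rewrite !indicE !in_setT !mul1r /exp_test /exp_testV -expRD ltr_expR.
  rewrite divfK// mulr0 !add0r /clip.
  by rewrite /Num.max /Num.min; repeat case: ifPn; rewrite -?leNgt; lra.
have s0 : Num.sqrt v != 0 by rewrite gt_eqF// sqrtr_gt0.
pose x := expR (- (c ^+ 2 / (8 * v))); pose z := expR (- (B / 2)).
have xz : x < z.
  rewrite ltr_expR ltrN2 ltr_pdivlMr; lra.
have x0 : 0 <= x by exact: expR_ge0.
have [k k0 kz] : exists2 k, 0 <= k & expR (- k) < z - x.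
  have zx : 0 < (z - x)^-1 by rewrite invr_gt0 subr_gt0.
  exists (z - x)^-1; first exact: ltW.
  rewrite expRN invf_plt ?posrE ?expR_gt0 ?subr_gt0//.
  by apply: lt_le_trans (expR_ge1Dx _); lra.
exists (c / (2 * v)), (- (c ^+ 2 / (4 * v))), k; split => //.
have -> : expR (- B) = z * z by rewrite -expRD; congr expR; field.
have vn0 : v != 0 by rewrite gt_eqF.
rewrite /centered_normal (negPf vn0).
apply: (@le_lt_trans _ _ ((x + expR (- k)) * (x + expR (- k)))); last first.
  have := expR_ge0 (- k); set r := expR (- k) in kz * => r0.
  by rewrite ltr_pM//; lra.
apply: ler_pM.
- by apply: Rintegral_ge0 => y _; exact: expR_ge0.
- by apply: Rintegral_ge0 => y _; exact: expR_ge0.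
- have -> : x = expR (- (c ^+ 2 / (4 * v)) + (c / (2 * v)) ^+ 2 * Num.sqrt v ^+ 2 / 2).
    by rewrite sqr_sqrtr ?ltW//; congr expR; field.
  apply: Rintegral_normal_le => //.
  + exact: continuous_exp_test.
  + by move=> y; exact: exp_test_bounds.
  + by move=> y; exact: exp_test_le.
- set b' := c / (2 * v) * c - c ^+ 2 / (4 * v).
  have -> : x = expR (- b' + (- (c / (2 * v))) ^+ 2 * Num.sqrt v ^+ 2 / 2).
    by rewrite sqr_sqrtr ?ltW// /b'; congr expR; field.
  apply: Rintegral_normal_le => //.
  + exact: continuous_exp_testV.
  + by move=> y; exact: exp_testV_bounds.
  + by move=> y; exact: exp_testV_le.
Qed.

End normal_tests.

Section L2_geometry.
Context {d : measure_display} {X : measurableType d} {R : realType}.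
Variable P : probability X R.
Implicit Types (f g h : L2 P) (V : set (L2 P)) (gamma : L2 P -> R).

Lemma L2norm_ge0 f : 0 <= L2norm f.
Proof. by rewrite fine_ge0// Lnorm_ge0. Qed.

Lemma L2norm_sqr f : L2norm f ^+ 2 = (\int[P]_x (f x ^+ 2))%R.
Proof.
have E : ((L2norm f)%:E = 'N[P]_2%:E[EFin \o f])%E by exact: finite_norm_fine.
apply: EFin_inj; rewrite EFin_L2_sqr -(powR_mulrn 2 (L2norm_ge0 f)).
rewrite -poweR_EFin E poweR_Lnorm//; apply: eq_integral => x _ /=.
by rewrite powR_mulrn// real_normK// num_real.
Qed.

Lemma L2norm0 : L2norm (0 : L2 P) = 0.
Proof. by rewrite /L2norm (_ : EFin \o _ = cst 0%E)// Lnorm0. Qed.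

Lemma L2norm_le_sub f g : L2norm f <= L2norm (f - g) + L2norm g.
Proof. by rewrite -{1}(subrK g f); exact: ler_LnormD. Qed.

Lemma L2dot_polarization f g :
  L2dot f g = (L2norm f ^+ 2 + L2norm g ^+ 2 - L2norm (f - g) ^+ 2) / 2.
Proof.
have iD : P.-integrable setT (EFin \o (fun x => f x ^+ 2 + g x ^+ 2)).
  exact: (integrableD measurableT (L2_integrable_sqr f) (L2_integrable_sqr g)).
have iB : P.-integrable setT
    (EFin \o (fun x => f x ^+ 2 + g x ^+ 2 - (f - g) x ^+ 2)).
  exact: (integrableB measurableT iD (L2_integrable_sqr (f - g))).
rewrite !L2norm_sqr -RintegralD//; [|exact: L2_integrable_sqr..].
rewrite -RintegralB//; last exact: (L2_integrable_sqr (f - g)).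
rewrite -RintegralZr//.
apply: eq_Rintegral => x _.
have -> : (f - g) x = f x - g x by [].
by field.
Qed.

Lemma span_subspace V : Defs.subspace V -> Defs.span V `<=` V.
Proof.
move=> [V0 VD _] _ [n [a [f [fV ->]]]].
elim/big_ind: _ => // [g h Vg Vh|i _].
  by rewrite -(scale1r g); exact: VD.
by rewrite -(addr0 (_ *: _)); exact: VD.
Qed.

Lemma efficiency_bound_ge0 gamma V : 0 <= efficiency_bound gamma V.
Proof. exact: sqr_ge0. Qed.

(* Without a Riesz representer the efficiency bound is [0], which [0 <= v]
   and [v < efficiency_bound gamma V] exclude. *)
Lemma efficient_direction gamma V (v : R) : Defs.subspace V ->
  0 <= v -> v < efficiency_bound gamma V ->
  exists2 h, V h & v * (\int[P]_x (h x ^+ 2))%R < gamma h ^+ 2.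
Proof.
move=> sV v0; rewrite /efficiency_bound.
case: xgetP => [psi _ [psiV psiE]|_]; last first.
  by rewrite L2norm0 expr0n/= ltNge v0.
set a := L2norm psi => va.
have a0 : 0 <= a by exact: L2norm_ge0.
set s := Num.sqrt v.
have s0 : 0 <= s by exact: sqrtr_ge0.
have sE : s ^+ 2 = v by rewrite sqr_sqrtr.
have sa : s < a by rewrite -(ltr_pXn2r (n := 2))// sE.
have : 0 < (a - s) / 2 by lra.
move=> /psiV[h /(span_subspace sV) Vh]; set e := L2norm _ => he.
exists h => //; rewrite -L2norm_sqr psiE// L2dot_polarization -/a -/e.
set b := L2norm h.
have e0 : 0 <= e by exact: L2norm_ge0.
have b0 : 0 <= b by exact: L2norm_ge0.
have ab : a <= e + b by exact: L2norm_le_sub.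
rewrite -sE -exprMn ltr_pXn2r ?nnegrE ?mulr_ge0//.
  nra.
nra.
Qed.

End L2_geometry.

Section sublinear.
Context {d : measure_display} {X : measurableType d} {R : realType}.
Variables (P : probability X R) (T : set (L2 P)).
Implicit Types (gamma : L2 P -> R) (V W : set (L2 P)).

Lemma subspaceN V f : Defs.subspace V -> V f -> V (- f).
Proof.
by move=> [V0 VD _] Vf; rewrite -scaleN1r -(addr0 (_ *: _)); exact: VD.
Qed.

Lemma subspace_convex_cone V : Defs.subspace V -> convex_cone V.
Proof.
move=> [V0 VD Vae]; split=> // [f g Vf Vg|a f _ Vf].
  by rewrite -(scale1r f); exact: VD.
by rewrite -(addr0 (_ *: _)); exact: VD.
Qed.

Lemma pos_homogeneous0 gamma : T 0 -> pos_homogeneous T gamma -> gamma 0 = 0.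
Proof. by move=> T0 /(_ 0 0 (lexx _) T0); rewrite scaler0 mul0r. Qed.

Lemma linearity_subspaceN gamma W :
  linearity_subspace T gamma W -> linearity_subspace T (fun h => - gamma h) W.
Proof.
move=> [sW WT Wlin]; split=> // a f g Wf Wg.
by rewrite Wlin// opprD mulrN.
Qed.

Lemma coreN gamma : core T (fun h => - gamma h) `<=` core T gamma.
Proof.
have NN h : Ngamma T gamma h <-> Ngamma T (fun h => - gamma h) h.
  rewrite /Ngamma/= -opprD; split=> -[Th]; first by move=> ->; rewrite oppr0.
  by move=> /eqP; rewrite oppr_eq0 => /eqP.
move=> w [/NN Nw wlin]; split=> // v c /NN Nv.
by have := wlin v c Nv; lra.
Qed.

Lemma sublinear_core gamma W : Defs.subspace T -> sublinear T gamma ->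
  linearity_subspace T gamma W -> W `<=` core T gamma.
Proof.
move=> sT [hom sub] [sW WT Wlin] w Ww; have [W0 WD _] := sW.
have [T0 TD _] := sT.
have g0 : gamma 0 = 0 by exact: pos_homogeneous0.
have Wscale c f : W f -> W (c *: f).
  by move=> Wf; rewrite -(addr0 (_ *: _)); exact: WD.
have lin c f : W f -> gamma (c *: f) = c * gamma f.
  by move=> Wf; rewrite -(addr0 (c *: f)) Wlin// g0 addr0.
have linN f : W f -> gamma (- f) = - gamma f.
  by move=> Wf; rewrite -scaleN1r lin// mulN1r.
split; first by split; [exact: WT|rewrite linN// subrr].
move=> v c [Tv Nv]; have Wcw := Wscale c w Ww.
have Tcw := WT _ Wcw; have Tv' := subspaceN sT Tv.
have Tcw' := subspaceN sT Tcw.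
have Tvcw : T (v + c *: w) by rewrite -(scale1r v); exact: TD.
have le1 := sub _ _ Tv Tcw.
have le2 := sub _ _ Tv' Tcw'.
have := sub _ _ Tvcw (subspaceN sT Tvcw).
rewrite subrr g0 opprD => le3.
move: le1 le2; rewrite (linN (c *: w))// (lin c w)// => le1 le2.
apply/eqP; rewrite eq_le; lra.
Qed.

End sublinear.

Section regularity.
Context {d : measure_display} {X : measurableType d} {R : realType}.
Variables (M : set (probability X R)) (P : probability X R).
Variables (Psi : probability X R -> R) (T : set (L2 P)) (gamma : L2 P -> R).
Hypotheses (MP : M P) (HT : tangent_space M T).
Hypothesis Hdiff : directionally_differentiable M Psi T gamma.

Lemma dqm_path_cst : dqm_path M (0 : L2 P) (fun=> P).
Proof.
split=> //; first by exists 1.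
rewrite (_ : (fun t => _) = fun=> 0%E); first exact: cvg_cst.
apply/funext => t; rewrite /dqm_remainder integral0_eq// => x _.
have -> : (0 : L2 P) x = 0 by [].
by rewrite subrr mul0r mulr0 mul0r subrr expr0n.
Qed.

Lemma root_n_derivative h Pt : T h -> dqm_path M h Pt ->
  Num.sqrt n%:R * (Psi (Pt (Num.sqrt n%:R)^-1) - Psi P) @[n --> \oo] -->
  gamma h.
Proof.
case: Hdiff => _ _ Hd Th hPt.
have := cvg_comp _ _ (@cvg_invsqrt_at_right R) (Hd _ _ Th hPt).
by apply: cvg_trans; apply: near_eq_cvg; near=> n => /=; rewrite invrK.
Unshelve. all: by end_near.
Qed.

Lemma efficient_not_regular (V V' : set (L2 P)) (v : R) Tn :
  0 <= v -> V 0 -> linearity_subspace T gamma V' ->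
  v < efficiency_bound gamma V' ->
  regular M Psi Tn V (centered_normal v) -> ~ is_regular M Psi Tn V'.
Proof.
move=> v0 V0 [sV' V'T V'lin] vV' regV [L' regV'].
have [h V'h vh] := efficient_direction sV' v0 vV'.
have [Pt hPt] : exists Pt, dqm_path M h Pt.
  by case: HT => _ _ _; apply; exact: V'T.
have HN := regV _ _ V0 dqm_path_cst.
have V'0 : V' 0 by case: sV'.
have HL' := regV' _ _ V'0 dqm_path_cst.
have HQ := regV' _ _ V'h hPt.
have Hc := root_n_derivative (V'T _ V'h) hPt.
set H := (\int[P]_x (h x ^+ 2))%R in vh.
have H0 : 0 <= H by apply: Rintegral_ge0 => x _; rewrite sqr_ge0.
have [B [B0 HB vB]] : exists B : R, [/\ 0 < B, H / 4 < B & v * (4 * B) < gamma h ^+ 2].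
  move: v0; rewrite le_eqVlt => /predU1P[v0|v0].
    by exists (H / 4 + 1); split; [lra|lra|move: vh; rewrite -v0 !mul0r].
  have Hv : H < gamma h ^+ 2 / v by rewrite ltr_pdivlMr// mulrC.
  exists ((H + gamma h ^+ 2 / v) / 8); split; [lra|lra|].
  rewrite (_ : v * _ = (v * H + gamma h ^+ 2) / 2); first by lra.
  by field; rewrite gt_eqF.
have [a [b [k [k0 lt]]]] := centered_normal_affinity B0 vB v0.
have := weak_limit_affinity a b hPt HB k0 HN HQ Hc.
rewrite leNgt (_ : (\int[L']_y _)%R =
  (\int[centered_normal v]_y exp_testV a (a * gamma h + b) k y)%R) ?lt//.
have bd : exists K, forall y, `|exp_testV a (a * gamma h + b) k y| <= K.
  exists (expR k) => y; have /andP[y0 yk] :=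
    exp_testV_bounds a (a * gamma h + b) y k0.
  by rewrite ger0_norm.
apply: (cvg_unique (@norm_hausdorff _ R) (HL' _ (@continuous_exp_testV _ _ _ _) bd)
  (HN _ (@continuous_exp_testV _ _ _ _) bd)).
Qed.

Lemma efficiency_bound_le_vbound (V : set (L2 P)) Tn :
  linearity_subspace T gamma V -> is_regular M Psi Tn V ->
  ((efficiency_bound gamma V)%:E <= vbound M Psi T gamma Tn)%E.
Proof.
move=> [sV VT _] regV; apply: ereal_sup_ubound; exists V => //.
by split=> //; exact: subspace_convex_cone.
Qed.

End regularity.

Theorem proposition5 (d : measure_display) (X : measurableType d)
    (R : realType) (M : set (probability X R)) (P : probability X R)
    (Psi : probability X R -> R) (T : set (L2 P)) (gamma : L2 P -> R)
    (MP : M P) (HT : tangent_space M T)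
    (Hdiff : directionally_differentiable M Psi T gamma) :
  (forall V V' : set (L2 P),
     linearity_subspace T gamma V -> linearity_subspace T gamma V' ->
     V `<` V' ->
     efficiency_bound gamma V < efficiency_bound gamma V' ->
     (forall Tn : estimator_sequence,
        efficient M Psi gamma Tn V -> ~ is_regular M Psi Tn V') /\
     (forall Tn : estimator_sequence,
        is_regular M Psi Tn V' ->
        ((efficiency_bound gamma V')%:E <= vbound M Psi T gamma Tn)%E /\
        efficiency_bound gamma V < efficiency_bound gamma V')) /\
  (sublinear T gamma \/ superlinear T gamma ->
     (forall W : set (L2 P),
        linearity_subspace T gamma W -> W `<=` core T gamma) /\
     (forall Tn : estimator_sequence,
        efficient M Psi gamma Tn (core T gamma) ->
        forall W : set (L2 P),
          linearity_subspace T gamma W -> is_regular M Psi Tn W)).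
Proof.
split=> [V V' linV linV' _ VV'|sl].
  split=> Tn.
    apply: (efficient_not_regular MP HT Hdiff _ _ linV' VV').
      exact: efficiency_bound_ge0.
    by case: linV => -[].
  by move=> regV'; split=> //; exact: efficiency_bound_le_vbound.
have sT : Defs.subspace T by case: HT.
have subcore W : linearity_subspace T gamma W -> W `<=` core T gamma.
  case: sl => sl linW; first exact: sublinear_core.
  apply: subset_trans (@coreN _ _ _ _ T gamma).
  by apply: sublinear_core => //; exact: linearity_subspaceN.
split=> // Tn eff W /subcore Wcore.
exists (centered_normal (efficiency_bound gamma (core T gamma))) => h Pt Wh.
by apply: eff; exact: Wcore.
Qed.
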